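(* Let $\mathcal{C}$ be a category with finite limits. Let $S:\mathbf{S}(\mathcal{C})\to\mathcal{C}$ be the simple fibration, let $\mathrm{sub}:\mathcal{C}^{\subseteq}\to\mathcal{C}$ be the subobject fibration, and let $P_2:\mathcal{C}^{\subseteq}\times_{\mathcal{C}}\mathbf{S}(\mathcal{C})\to\mathbf{S}(\mathcal{C})$ be the pullback of $\mathrm{sub}$ along the functor $\times:\mathbf{S}(\mathcal{C})\to\mathcal{C}$. Then the total category of the iterated dual of the tower of fibrations $$\mathcal{C}^{\subseteq}\times_{\mathcal{C}}\mathbf{S}(\mathcal{C})\xrightarrow{P_2}\mathbf{S}(\mathcal{C})\xrightarrow{P_1=S}\mathcal{C}$$ is isomorphic to the simple Dialectica category $\mathbf{Dial}_\times(\mathcal{C})$.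
   Context: Fibrations are Grothendieck fibrations with chosen cartesian lifts. Simple fibration: $\mathbf{S}(\mathcal{C})$ has as objects pairs $(I,X)$ of objects of $\mathcal{C}$, and as morphisms $(I,X)\to(J,Y)$ pairs $(u:I\to J,\ f:I\times X\to Y)$, with composition $(u,f)$ followed by $(v,g)$ given by $(v\circ u,\ (i,x)\mapsto g(u(i),f(i,x)))$. The functor $S$ is $S(I,X)=I$, $S(u,f)=u$. The functor $\times:\mathbf{S}(\mathcal{C})\to\mathcal{C}$ sends $(I,X)$ to $I\times X$ and $(u,f)$ to $(i,x)\mapsto(u(i),f(i,x))$. Subobject fibration: the fiber of $\mathrm{sub}$ over $I$ is the poset $\mathrm{Sub}(I)$ of subobjects of $I$, with reindexing by pullback. So the fiber of $P_2$ over $(U,X)$ is $\mathrm{Sub}(U\times X)$. Simple Dialectica category $\mathbf{Dial}_\times(\mathcal{C})$: objects are triples $(U,X,\alpha)$ with $U,X$ objects of $\mathcal{C}$ and $\alpha\in\mathrm{Sub}(U\times X)$. Morphisms $(U,X,\alpha)\to(V,Y,\beta)$ are pairs $f:U\to V$, $f^\sharp:U\times Y\to X$ in $\mathcal{C}$ satisfying, for generalized elements $u:U$, $y:Y$, the condition $\alpha(u,f^\sharp(u,y))\subseteq\beta(f(u),y)$, i.e. $\langle\pi_U,f^\sharp\rangle^*\alpha\le(f\times Y)^*\beta$ in $\mathrm{Sub}(U\times Y)$. The composite of $(f,f^\sharp)$ with $(g,g^\sharp):(V,Y,\beta)\to(W,Z,\gamma)$ is $(g\circ f,\ (u,z)\mapsto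 f^\sharp(u,g^\sharp(f(u),z)))$. Dual fibration: for a fibration $P:\mathcal{E}\to\mathcal{X}$, the dual $P^{\vee_{\mathcal{X}}}:\mathcal{E}^{\vee_{\mathcal{X}}}\to\mathcal{X}$ is the Grothendieck construction of the indexed category sending $X$ to the opposite of the fiber of $P$ over $X$; explicitly $\mathcal{E}^{\vee_{\mathcal{X}}}$ has the objects of $\mathcal{E}$, and morphisms $E\to D$ are pairs $(f:P(E)\to P(D),\ \psi:f^*D\to E)$ with $\psi$ in the fiber over $P(E)$. It is functorial on cartesian-arrow-preserving functors over $\mathcal{X}$. Iterated dual of a tower of height 2: given fibrations $\mathcal{E}_2\xrightarrow{P_2}\mathcal{E}_1\xrightarrow{P_1}\mathcal{E}_0$, form the dual fibration $\mathcal{E}_2^{\vee_{\mathcal{E}_1}}\to\mathcal{E}_1$ and then take duals over $\mathcal{E}_0$ of this map, viewed as a map of fibrations over $\mathcal{E}_0$. The total category of the iterated dual is $(\mathcal{E}_2^{\vee_{\mathcal{E}_1}})^{\vee_{\mathcal{E}_0}}$. *)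

(* Defs.v *)
From Stdlib Require Import ssreflect List FinFun.
From Stdlib Require Import FunctionalExtensionality PropExtensionality.
From Stdlib Require Import ProofIrrelevance ClassicalEpsilon.

Set Implicit Arguments.
Unset Strict Implicit.
Unset Printing Implicit Defensive.

Definition the {A : Type} {P : A -> Prop} (h : exists! x, P x) : A :=
  proj1_sig (constructive_definite_description P h).

Lemma theP {A : Type} {P : A -> Prop} (h : exists! x, P x) : P (the h).
Proof. exact: proj2_sig (constructive_definite_description P h). Qed.

Record category : Type := Category {
  ob :> Type;
  hom : ob -> ob -> Type;
  idm : forall x, hom x x;
  comp : forall x y z, hom y z -> hom x y -> hom x z;
  comp1m : forall x y (f : hom x y), comp (idm y) f = f;
  compm1 : forall x y (f : hom x y), comp f (idm x) = f;
  compA : forall w x y z (h : hom y z) (g : hom x y) (f : hom w x),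
    comp h (comp g f) = comp (comp h g) f
}.
Arguments hom {c} x y.
Arguments idm {c} x.
Arguments comp {c x y z} g f.
Notation "g ∘ f" := (comp g f) (at level 40, left associativity).

Record functor (C D : category) : Type := Functor {
  fob :> C -> D;
  fmap : forall x y, hom x y -> hom (fob x) (fob y);
  fmap1 : forall x, fmap (idm x) = idm (fob x);
  fmapM : forall x y z (g : hom y z) (f : hom x y),
    fmap (g ∘ f) = fmap g ∘ fmap f
}.
Arguments fmap {C D} F {x y} f : rename.

Program Definition functor_id (C : category) : functor C C :=
  {| fob := fun x => x; fmap := fun x y f => f |}.

Program Definition functor_comp (C D E : category)
    (G : functor D E) (F : functor C D) : functor C E :=
  {| fob := fun x => G (F x); fmap := fun x y f => fmap G (fmap F f) |}.
Next Obligation. by rewrite !fmap1. Qed.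
Next Obligation. by rewrite !fmapM. Qed.

(* Isomorphism, not equivalence: the composites are equal to the identities. *)
Definition cat_isomorphic (C D : category) : Prop :=
  exists (F : functor C D) (G : functor D C),
    functor_comp G F = functor_id C /\ functor_comp F G = functor_id D.

Definition finite_category (J : category) : Prop :=
  Finite J /\ forall x y : J, Finite (hom x y).

Definition is_cone (J C : category) (D : functor J C) (X : C)
    (a : forall j, hom X (D j)) : Prop :=
  forall i j (f : hom i j), fmap D f ∘ a i = a j.

Record limit (J C : category) (D : functor J C) : Type := Limit {
  lim_ob : C;
  lim_leg : forall j, hom lim_ob (D j);
  lim_cone : is_cone lim_leg;
  lim_univ : forall (X : C) (a : forall j, hom X (D j)), is_cone a ->
    exists! h : hom X lim_ob, forall j, lim_leg j ∘ h = a j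
}.

(* A choice of limits, hence in particular of binary products. *)
Definition finite_limits (C : category) : Type :=
  forall (J : category) (D : functor J C), finite_category J -> limit D.

Program Definition preorder_cat (T : Type) (r : T -> T -> bool)
    (r_refl : forall x, r x x = true)
    (r_trans : forall x y z, r y z = true -> r x y = true -> r x z = true) :
    category :=
  {| ob := T; hom := fun x y => r x y = true;
     idm := r_refl; comp := r_trans |}.
Next Obligation. exact: proof_irrelevance. Qed.
Next Obligation. exact: proof_irrelevance. Qed.
Next Obligation. exact: proof_irrelevance. Qed.

Lemma finite_eqtrue (b : bool) : Finite (b = true).
Proof.
case: b; last by exists nil => h; discriminate h.
by exists (cons eq_refl nil) => h; left; apply: proof_irrelevance.
Qed.

Definition discr2_rel (x y : bool) : bool := Bool.eqb x y.

Definition discr2 : category.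
Proof.
by refine (@preorder_cat bool discr2_rel _ _); [case | do 3 case].
Defined.

Lemma discr2_finite : finite_category discr2.
Proof.
split; last by move=> x y; apply: finite_eqtrue.
by exists (cons true (cons false nil)); case; [left | right; left].
Qed.

Program Definition pair_diagram (C : category) (A B : C) : functor discr2 C :=
  {| fob := fun b : discr2 => if b : bool then A else B;
     fmap := fun x y =>
       match x, y return hom (c := discr2) x y ->
         hom (if x then A else B) (if y then A else B) with
       | true, true => fun _ => idm A
       | false, false => fun _ => idm B
       | true, false | false, true => fun h => match Bool.diff_false_true h with end
       end |}.
Next Obligation. by case: x. Qed.
Next Obligation.
by case: x f g; case: y; case: z => f g //=; rewrite comp1m.
Qed.

Record products (C : category) : Type := Products {
  prod_ob : C -> C -> C;
  pr1 : forall A B, hom (prod_ob A B) A;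
  pr2 : forall A B, hom (prod_ob A B) B;
  prod_univ : forall A B X (f : hom X A) (g : hom X B),
    exists! h : hom X (prod_ob A B), pr1 A B ∘ h = f /\ pr2 A B ∘ h = g
}.
Arguments prod_ob {C} p A B : simpl never.
Arguments pr1 {C} p A B : simpl never.
Arguments pr2 {C} p A B : simpl never.

Definition finlim_products (C : category) (L : finite_limits C) : products C.
Proof.
pose l A B := L discr2 (pair_diagram A B) discr2_finite.
refine (@Products C (fun A B => lim_ob (l A B))
  (fun A B => lim_leg (l A B) true) (fun A B => lim_leg (l A B) false) _).
move=> A B X f g.
pose a := fun b : discr2 =>
  (if b as b return hom X (pair_diagram A B b) then f else g).
have acone : is_cone (D := pair_diagram A B) a.
  by case; case=> //= h; rewrite comp1m.
have [h [hP hU]] := lim_univ (l A B) acone.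
exists h; split; first by split; [apply: (hP true) | apply: (hP false)].
by move=> k [k1 k2]; apply: hU; case.
Defined.

Section Products.
Variables (C : category) (p : products C).

Definition pairing A B X (f : hom X A) (g : hom X B) : hom X (prod_ob p A B) :=
  the (prod_univ p f g).

Lemma pr1_pairing A B X (f : hom X A) (g : hom X B) :
  pr1 p A B ∘ pairing f g = f.
Proof. exact: proj1 (theP (prod_univ p f g)). Qed.

Lemma pr2_pairing A B X (f : hom X A) (g : hom X B) :
  pr2 p A B ∘ pairing f g = g.
Proof. exact: proj2 (theP (prod_univ p f g)). Qed.

Lemma prod_ext A B X (h k : hom X (prod_ob p A B)) :
  pr1 p A B ∘ h = pr1 p A B ∘ k -> pr2 p A B ∘ h = pr2 p A B ∘ k -> h = k.
Proof.
move=> e1 e2.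
have [m [_ mU]] := prod_univ p (pr1 p A B ∘ k) (pr2 p A B ∘ k).
by rewrite -(mU h) // -(mU k).
Qed.

Lemma pairing_comp A B X Y (f : hom X A) (g : hom X B) (h : hom Y X) :
  pairing f g ∘ h = pairing (f ∘ h) (g ∘ h).
Proof.
by apply: prod_ext; rewrite compA ?pr1_pairing ?pr2_pairing.
Qed.

Lemma pairing_pr A B : pairing (pr1 p A B) (pr2 p A B) = idm _.
Proof. by apply: prod_ext; rewrite compm1 ?pr1_pairing ?pr2_pairing. Qed.
End Products.
Arguments pairing {C} p {A B X} f g.

Definition is_pullback (C : category) (I J M N : C)
    (f : hom I J) (m : hom M J) (n : hom N I) (q : hom N M) : Prop :=
  f ∘ n = m ∘ q /\
  forall X (a : hom X I) (b : hom X M), f ∘ a = m ∘ b ->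
    exists! h : hom X N, n ∘ h = a /\ q ∘ h = b.

(* The walking cospan, [None] being the common target. *)
Definition cospan_rel (x y : option bool) : bool :=
  match x, y with
  | _, None => true
  | Some a, Some b => Bool.eqb a b
  | None, Some _ => false
  end.

Definition cospan : category.
Proof.
refine (@preorder_cat (option bool) cospan_rel _ _); first by case=> [[]|].
by case=> [[]|]; case=> [[]|]; case=> [[]|].
Defined.

Lemma cospan_finite : finite_category cospan.
Proof.
split; last by move=> x y; apply: finite_eqtrue.
exists (cons None (cons (Some true) (cons (Some false) nil))).
case=> [[]|]; [by right; left | by right; right; left | by left].
Qed.

Program Definition cospan_diagram (C : category) (I M J : C)
    (f : hom I J) (m : hom M J) : functor cospan C :=
  let o (x : option bool) :=
    match x with Some true => I | Some false => M | None => J end in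
  {| fob := o : cospan -> C;
     fmap := fun x y =>
       match x, y return hom (c := cospan) x y -> hom (o x) (o y) with
       | Some true, Some true => fun _ => idm I
       | Some false, Some false => fun _ => idm M
       | None, None => fun _ => idm J
       | Some true, None => fun _ => f
       | Some false, None => fun _ => m
       | Some true, Some false | Some false, Some true
       | None, Some _ => fun h => match Bool.diff_false_true h with end
       end |}.
Next Obligation. by case: x => [[]|]. Qed.
Next Obligation.
by case: x f0 g => [[]|]; case: y => [[]|]; case: z => [[]|] h k //=;
  rewrite ?comp1m ?compm1.
Qed.

Lemma finlim_pullback (C : category) (L : finite_limits C) (I M J : C)
    (f : hom I J) (m : hom M J) :
  exists N (n : hom N I) (q : hom N M), is_pullback f m n q.
Proof.
pose l := L cospan (cospan_diagram f m) cospan_finite.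
exists (lim_ob l), (lim_leg l (Some true)), (lim_leg l (Some false)).
have e1 := lim_cone l (i := Some true) (j := None) eq_refl.
have e2 := lim_cone l (i := Some false) (j := None) eq_refl.
split; first by rewrite [LHS]e1 [RHS]e2.
move=> X a b eab.
pose c := fun x : cospan =>
  match x as x return hom X (cospan_diagram f m x) with
  | Some true => a | Some false => b | None => f ∘ a end.
have ccone : is_cone (D := cospan_diagram f m) c.
  by case=> [[]|]; case=> [[]|] h //=; rewrite comp1m.
have [h [hP hU]] := lim_univ l ccone.
exists h; split; first by split; [apply: (hP (Some true)) | apply: (hP (Some false))].
move=> k [k1 k2]; apply: hU; case=> [[]|] //=.
by rewrite -[in LHS]e1 /= -compA k1.
Qed.

Section Subobjects.
Variables (C : category) (L : finite_limits C).

Definition is_mono (A I : C) (m : hom A I) : Prop :=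
  forall X (a b : hom X A), m ∘ a = m ∘ b -> a = b.

Record mono (I : C) : Type := Mono {
  mono_dom : C;
  mono_arr :> hom mono_dom I;
  monoP : is_mono mono_arr
}.

Definition mono_le I (m n : mono I) : Prop :=
  exists h : hom (mono_dom m) (mono_dom n), n ∘ h = m.

Definition mono_equiv I (m n : mono I) : Prop := mono_le m n /\ mono_le n m.

Lemma mono_le_refl I (m : mono I) : mono_le m m.
Proof. by exists (idm _); rewrite compm1. Qed.

Lemma mono_le_trans I (m n k : mono I) :
  mono_le m n -> mono_le n k -> mono_le m k.
Proof. by move=> [a ea] [b eb]; exists (b ∘ a); rewrite compA eb. Qed.

(* A subobject is an equivalence class of monomorphisms, so that subobjects
   form a poset and not merely a preorder. *)
Definition Sub (I : C) : Type :=
  {S : mono I -> Prop | exists m, forall n, S n <-> mono_equiv m n}.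

Definition represents I (m : mono I) (S : Sub I) : Prop := proj1_sig S m.

Lemma representative I (S : Sub I) : exists m, represents m S.
Proof.
case: S => S [m mS]; exists m; apply/mS; split; exact: mono_le_refl.
Qed.

Lemma represents_equiv I (S : Sub I) (m n : mono I) :
  represents m S -> (represents n S <-> mono_equiv m n).
Proof.
case: S => S [k kS] /kS [km mk]; rewrite /represents /= kS.
split=> - [h1 h2]; split; first [exact: mono_le_trans mk h1
  | exact: mono_le_trans h2 km | exact: mono_le_trans km h1
  | exact: mono_le_trans h2 mk].
Qed.

Definition sub_le I (S T : Sub I) : Prop :=
  exists m n, represents m S /\ represents n T /\ mono_le m n.

Lemma sub_le_mono I (S T : Sub I) (m n : mono I) :
  represents m S -> represents n T -> (sub_le S T <-> mono_le m n).
Proof.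
move=> mS nT; split; last by move=> h; exists m, n.
case=> m' [n' [m'S [n'T h]]].
have [mm' _] := proj1 (represents_equiv m' mS) m'S.
have [_ n'n] := proj1 (represents_equiv n' nT) n'T.
exact: mono_le_trans mm' (mono_le_trans h n'n).
Qed.

Lemma sub_le_refl I (S : Sub I) : sub_le S S.
Proof.
by have [m mS] := representative S; exists m, m; do 2?split=> //; apply: mono_le_refl.
Qed.

Lemma sub_le_trans I (S T U : Sub I) : sub_le S T -> sub_le T U -> sub_le S U.
Proof.
have [m mS] := representative S; have [n nT] := representative T.
have [k kU] := representative U.
move=> /(sub_le_mono mS nT) h /(sub_le_mono nT kU) h'.
apply/(sub_le_mono mS kU); exact: mono_le_trans h h'.
Qed.

Lemma sub_le_anti I (S T : Sub I) : sub_le S T -> sub_le T S -> S = T.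
Proof.
have [m mS] := representative S; have [n nT] := representative T.
move=> /(sub_le_mono mS nT) h /(sub_le_mono nT mS) h'.
have e : proj1_sig S = proj1_sig T.
  apply: functional_extensionality => k; apply: propositional_extensionality.
  have := represents_equiv k mS; have := represents_equiv k nT.
  rewrite /represents => -> ->.
  split=> - [h1 h2]; split; first [exact: mono_le_trans h' h1
    | exact: mono_le_trans h2 h | exact: mono_le_trans h h1
    | exact: mono_le_trans h2 h'].
case: S T e {mS nT h h'} => S HS [T HT] /= e; subst T.
by f_equal; apply: proof_irrelevance.
Qed.

Definition mono_pullback I J (f : hom I J) (m : mono J) (n : mono I) : Prop :=
  exists q, is_pullback f m n q.

Lemma mono_pullbackP I J (f : hom I J) (m : mono J) :
  exists n, mono_pullback f m n.
Proof.
have [N [n [q nP]]] := finlim_pullback L f m.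
have nM : is_mono n.
  move=> X a b eab; case: (nP) => sq univ.
  have eq : q ∘ a = q ∘ b.
    by apply: (monoP (m := m)); rewrite !compA -sq -!compA eab.
  have [h [_ hU]] := univ X (n ∘ b) (q ∘ b) ltac:(by rewrite !compA sq).
  by rewrite -(hU a) // -(hU b).
by exists (Mono nM), q.
Qed.

Lemma mono_pullback_le I J (f : hom I J) (m m' : mono J) (n n' : mono I) :
  mono_pullback f m n -> mono_pullback f m' n' -> mono_le m m' -> mono_le n n'.
Proof.
move=> [q [sq _]] [q' [_ univ]] [h eh].
have [k [[kP _] _]] := univ _ n (h ∘ q) ltac:(by rewrite sq -eh compA).
by exists k.
Qed.

Lemma mono_pullback_equiv I J (f : hom I J) (m : mono J) (n n' : mono I) :
  mono_pullback f m n -> mono_equiv n n' -> mono_pullback f m n'.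
Proof.
move=> [q [sq univ]] [[h eh] [h' eh']]; exists (q ∘ h'); split.
  by rewrite -eh' !compA sq.
move=> X a b eab; have [k [[k1 k2] kU]] := univ X a b eab.
exists (h ∘ k); split; first split.
- by rewrite compA eh.
- rewrite -k2 -compA; congr (q ∘ _); rewrite compA -[RHS]comp1m.
  congr (_ ∘ k); apply: (monoP (m := n)).
  by rewrite compA eh' eh compm1.
- by move=> l [l1 _]; apply: (monoP (m := n')); rewrite compA eh k1.
Qed.

(* Reindexing along [f]: the class of all pullbacks of representatives. *)
Definition sub_pb I J (f : hom I J) (S : Sub J) : Sub I.
Proof.
exists (fun n => exists m, represents m S /\ mono_pullback f m n).
have [m mS] := representative S; have [n nP] := mono_pullbackP f m.
exists n => n'; split; last first.
  by move=> h; exists m; split=> //; apply: mono_pullback_equiv nP h.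
move=> [m' [m'S n'P]].
have [h h'] := proj1 (represents_equiv m' mS) m'S.
by split; [apply: mono_pullback_le nP n'P h | apply: mono_pullback_le n'P nP h'].
Defined.

Lemma sub_pb_le I J (f : hom I J) (S : Sub I) (T : Sub J) (m : mono I) (n : mono J) :
  represents m S -> represents n T ->
  (sub_le S (sub_pb f T) <-> exists h, f ∘ m = n ∘ h).
Proof.
move=> mS nT; have [k kP] := mono_pullbackP f n.
have kT : represents k (sub_pb f T) by exists n.
rewrite (sub_le_mono mS kT); case: kP => q [sq univ]; split.
  by move=> [h <-]; exists (q ∘ h); rewrite !compA sq.
by move=> [h /univ [l [[l1 _] _]]]; exists l.
Qed.

Lemma sub_pb_id I (S : Sub I) : sub_pb (idm I) S = S.
Proof.
have [m mS] := representative S.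
apply: sub_le_anti; last first.
  by apply/(sub_pb_le _ mS mS); exists (idm _); rewrite comp1m compm1.
have [k kP] := mono_pullbackP (idm I) m.
have kT : represents k (sub_pb (idm I) S) by exists m.
apply/(sub_le_mono kT mS); case: kP => q [sq _].
by exists q; rewrite -sq comp1m.
Qed.

Lemma sub_pb_comp I J K (g : hom J K) (f : hom I J) (S : Sub K) :
  sub_pb (g ∘ f) S = sub_pb f (sub_pb g S).
Proof.
have [m mS] := representative S.
have [n nP] := mono_pullbackP g m.
have nT : represents n (sub_pb g S) by exists m.
have [k kP] := mono_pullbackP (g ∘ f) m.
have kT : represents k (sub_pb (g ∘ f) S) by exists m.
have [l lP] := mono_pullbackP f n.
have lT : represents l (sub_pb f (sub_pb g S)) by exists n.
case: (nP) => q [sq univ].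
apply: sub_le_anti.
  apply/(sub_pb_le _ kT nT); case: kP => q' [sq' _].
  have [h [[h1 _] _]] := univ _ (f ∘ k) q' ltac:(by rewrite compA).
  by exists h.
apply/(sub_pb_le _ lT mS); case: lP => q' [sq' _].
by exists (q ∘ q'); rewrite -compA sq' !compA sq.
Qed.

Lemma sub_pb_mono I J (f : hom I J) (S T : Sub J) :
  sub_le S T -> sub_le (sub_pb f S) (sub_pb f T).
Proof.
have [m mS] := representative S; have [n nT] := representative T.
have [k kP] := mono_pullbackP f m; have [l lP] := mono_pullbackP f n.
have kT : represents k (sub_pb f S) by exists m.
have lT : represents l (sub_pb f T) by exists n.
move=> /(sub_le_mono mS nT) h; apply/(sub_le_mono kT lT).
exact: mono_pullback_le kP lP h.
Qed.
End Subobjects.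

Definition eqh {C : category} {x y : C} (e : x = y) : hom x y :=
  match e with eq_refl => idm x end.

(* [k] lies over [u]; as its ends lie over those of [u] only up to a
   propositional equality, the comparison goes through [eqh]. *)
Definition over (E B : category) (P : functor E B) (A A' : E) (k : hom A A')
    (I I' : B) (u : hom I I') : Prop :=
  exists (e : P A = I) (e' : P A' = I'), eqh e' ∘ fmap P k = u ∘ eqh e.

Definition is_cartesian (E B : category) (P : functor E B) (A D : E)
    (l : hom A D) : Prop :=
  forall K (h : hom K D) (w : hom (P K) (P A)), fmap P h = fmap P l ∘ w ->
    exists! k : hom K A, l ∘ k = h /\ fmap P k = w.

Record cleavage (E B : category) (P : functor E B) : Type := Cleavage {
  lift_ob : forall (D : E) (I : B) (u : hom I (P D)), E;
  lift : forall D I (u : hom I (P D)), hom (lift_ob u) D;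
  lift_over : forall D I (u : hom I (P D)), over P (lift u) u;
  lift_cartesian : forall D I (u : hom I (P D)), is_cartesian P (lift u)
}.
Arguments lift_ob {E B P} c {D I} u.
Arguments lift {E B P} c {D I} u.
Arguments lift_over {E B P} c {D I} u.
Arguments lift_cartesian {E B P} c {D I} u.

Record fibration (E B : category) : Type := Fibration {
  fproj :> functor E B;
  fcleav : cleavage fproj
}.
Arguments fcleav {E B} f.

Lemma eqh_id (C : category) (x : C) (e : x = x) : eqh e = idm x.
Proof. by rewrite (proof_irrelevance _ e eq_refl). Qed.

Lemma eqh_trans (C : category) (x y z : C) (e' : y = z) (e : x = y) :
  eqh e' ∘ eqh e = eqh (eq_trans e e').
Proof. by case: _ / e' => /=; rewrite comp1m. Qed.

Lemma eqhK (C : category) (x y : C) (e : x = y) : eqh (eq_sym e) ∘ eqh e = idm x.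
Proof. by rewrite eqh_trans eqh_id. Qed.

Lemma eqhKV (C : category) (x y : C) (e : x = y) : eqh e ∘ eqh (eq_sym e) = idm y.
Proof. by rewrite eqh_trans eqh_id. Qed.

Lemma fmap_eqh (C D : category) (F : functor C D) (x y : C) (e : x = y) :
  fmap F (eqh e) = eqh (f_equal F e).
Proof. by case: _ / e => /=; rewrite fmap1. Qed.

Section Over.
Variables (E B : category) (P : functor E B).

Lemma over_fmap (A A' : E) (k : hom A A') : over P k (fmap P k).
Proof. by exists eq_refl, eq_refl; rewrite /= comp1m compm1. Qed.

Lemma over_id (A : E) I : P A = I -> over P (idm A) (idm I).
Proof. by move=> e; exists e, e; rewrite fmap1 comp1m compm1. Qed.

Lemma over_comp (A A' A'' : E) (k' : hom A' A'') (k : hom A A')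
    (I I' I'' : B) (u' : hom I' I'') (u : hom I I') :
  over P k' u' -> over P k u -> over P (k' ∘ k) (u' ∘ u).
Proof.
move=> [e1 [e2 h']] [e3 [e4 h]]; exists e3, e2; rewrite fmapM compA h'.
by rewrite (proof_irrelevance _ e1 e4) -compA h compA.
Qed.

Lemma over_eq (A A' : E) (k : hom A A') (I I' : B) (u v : hom I I') :
  over P k u -> u = v -> over P k v.
Proof. by move=> h <-. Qed.

Lemma over_src (A A' : E) (k : hom A A') (I I' : B) (u : hom I I') :
  over P k u -> P A = I.
Proof. by case. Qed.

Lemma over_fun (A A' : E) (k : hom A A') (I I' : B) (u v : hom I I') :
  over P k u -> over P k v -> u = v.
Proof.
move=> [e1 [e2 h]] [e3 [e4 h']]; subst I I'.
by move: h h'; rewrite !eqh_id !compm1 => <- <-.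
Qed.

Lemma cart_factor (A D K : E) (l : hom A D) (h : hom K D) (I J N : B)
    (u : hom I J) (w : hom N I) :
  is_cartesian P l -> over P l u -> over P h (u ∘ w) ->
  exists! k : hom K A, l ∘ k = h /\ over P k w.
Proof.
move=> lc [e1 [e2 hl]] [e3 [e4 hh]]; subst I J N.
move: hl hh; rewrite !eqh_id /= !comp1m !compm1 => hl hh.
have [k [[k1 k2] kU]] := lc K h w ltac:(by rewrite hh hl).
exists k; split; first by split=> //; rewrite -k2; apply: over_fmap.
move=> k' [k'1 [e5 [e6 hk']]]; apply: kU; split=> //.
by move: hk'; rewrite !eqh_id comp1m compm1.
Qed.

Lemma cart_inj (A D K : E) (l : hom A D) (k k' : hom K A) (I J N : B)
    (u : hom I J) (w : hom N I) :
  is_cartesian P l -> over P l u -> over P k w -> over P k' w ->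
  l ∘ k = l ∘ k' -> k = k'.
Proof.
move=> lc lu kw k'w e.
have [m [_ mU]] := cart_factor lc lu (over_comp lu kw).
by rewrite -(mU k) // -(mU k').
Qed.

End Over.

Section Composite.
Variables (E2 E1 E0 : category) (P2 : fibration E2 E1) (P1 : fibration E1 E0).
Let P := functor_comp P1 P2.

Lemma over_functor_comp (A A' : E2) (k : hom A A') (X X' : E1) (v : hom X X')
    (I I' : E0) (u : hom I I') :
  over P2 k v -> over P1 v u -> over P k u.
Proof.
move=> [e1 [e2 h]] [e3 [e4 h']]; subst X X' I I'.
move: h h'; rewrite /= !comp1m !compm1 => <- <-.
exact: (over_fmap P).
Qed.

Lemma comp_cartesian (A D : E2) (l : hom A D) :
  is_cartesian P2 l -> is_cartesian P1 (fmap P2 l) -> is_cartesian P l.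
Proof.
move=> c2 c1 K h w hw.
have [v [[v1 v2] vU]] := c1 _ (fmap P2 h) w hw.
have [k [[k1 k2] kU]] := c2 _ h v (eq_sym v1).
exists k; split; first by split=> //=; rewrite k2.
move=> k' [k'1 k'2]; apply: kU; split=> //; symmetry; apply: vU.
by split=> //; rewrite -fmapM k'1.
Qed.

Lemma over_cart (A D : E2) (l : hom A D) (X : E1) (v : hom X (P2 D)) :
  over P2 l v -> is_cartesian P1 v -> is_cartesian P1 (fmap P2 l).
Proof.
move=> [e [e' h]] vc; subst X; move: h; rewrite !eqh_id comp1m compm1.
by move=> ->.
Qed.

Definition comp_lift_ob (D : E2) (I : E0) (u : hom I (P D)) : E2 :=
  lift_ob (fcleav P2) (lift (fcleav P1) (u : hom I (P1 (P2 D)))).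

Definition comp_lift (D : E2) (I : E0) (u : hom I (P D)) :
    hom (comp_lift_ob u) D :=
  lift (fcleav P2) (lift (fcleav P1) (u : hom I (P1 (P2 D)))).

Definition comp_cleavage : cleavage P.
Proof.
refine (@Cleavage _ _ P comp_lift_ob comp_lift _ _) => D I u.
  exact: over_functor_comp (lift_over _ _) (lift_over _ _).
apply: comp_cartesian; first exact: lift_cartesian.
exact: over_cart (lift_over _ _) (lift_cartesian _ _).
Defined.

Definition comp_fibration : fibration E2 E0 := Fibration comp_cleavage.
End Composite.

Section Pullback.
Variables (E B B' : category) (P : fibration E B) (Q : functor B' B).

Record pb_ob : Type := PbOb {
  pb_top : E;
  pb_base : B';
  pb_eq : P pb_top = Q pb_base
}.

Record pb_hom (x y : pb_ob) : Type := PbHom {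
  pb_htop : hom (pb_top x) (pb_top y);
  pb_hbase : hom (pb_base x) (pb_base y);
  pb_heq : eqh (pb_eq y) ∘ fmap P pb_htop = fmap Q pb_hbase ∘ eqh (pb_eq x)
}.

Lemma pb_hom_ext x y (f g : pb_hom x y) :
  pb_htop f = pb_htop g -> pb_hbase f = pb_hbase g -> f = g.
Proof.
case: f g => f f' ef [g g' eg] /= e e'; subst g g'.
by f_equal; apply: proof_irrelevance.
Qed.

Definition pb_id (x : pb_ob) : pb_hom x x.
Proof. by exists (idm _) (idm _); rewrite !fmap1 comp1m compm1. Defined.

Definition pb_comp x y z (g : pb_hom y z) (f : pb_hom x y) : pb_hom x z.
Proof.
exists (pb_htop g ∘ pb_htop f) (pb_hbase g ∘ pb_hbase f).
by rewrite !fmapM compA pb_heq -!compA pb_heq.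
Defined.

Definition pb_cat : category.
Proof.
refine (@Category pb_ob pb_hom pb_id pb_comp _ _ _).
- by move=> *; apply: pb_hom_ext; apply: comp1m.
- by move=> *; apply: pb_hom_ext; apply: compm1.
- by move=> *; apply: pb_hom_ext; apply: compA.
Defined.

Definition pb_proj : functor pb_cat B'.
Proof. by refine (@Functor pb_cat B' pb_base pb_hbase _ _). Defined.

Section Lift.
Variables (D : pb_ob) (I : B') (u : hom I (pb_base D)).

(* [Q u], seen with target [P (pb_top D)]. *)
Definition pb_below : hom (Q I) (P (pb_top D)) := eqh (eq_sym (pb_eq D)) ∘ fmap Q u.

Definition pb_lift_ob : pb_ob :=
  PbOb (over_src (lift_over (fcleav P) pb_below)).

Definition pb_lift : pb_hom pb_lift_ob D.
Proof.
exists (lift (fcleav P) pb_below) u.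
have [e [e' h]] := lift_over (fcleav P) pb_below.
move: h; rewrite eqh_id comp1m /= => ->.
rewrite /pb_below !compA eqhKV comp1m.
by rewrite (proof_irrelevance _ e (over_src (lift_over (fcleav P) pb_below))).
Defined.
End Lift.

Definition pb_cleavage : cleavage pb_proj.
Proof.
refine (@Cleavage pb_cat B' pb_proj pb_lift_ob pb_lift _ _) => D I u.
  by exists eq_refl, eq_refl; rewrite /= comp1m compm1.
move=> K h w /= hw.
have lo := lift_over (fcleav P) (pb_below u).
have lc := lift_cartesian (fcleav P) (pb_below u).
have ho : over P (pb_htop h) (pb_below u ∘ fmap Q w).
  exists (pb_eq K), eq_refl; rewrite /= comp1m /pb_below -(compA (eqh _)) -fmapM -hw.
  by rewrite -compA -pb_heq compA eqhK comp1m.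
have [k [[k1 [e [e' k2]]] kU]] := cart_factor lc lo ho.
have ek : eqh (pb_eq (pb_lift_ob u)) ∘ fmap P k = fmap Q w ∘ eqh (pb_eq K).
  by rewrite (proof_irrelevance _ (pb_eq K) e) -k2;
     rewrite (proof_irrelevance _ (pb_eq (pb_lift_ob u)) e').
exists (PbHom ek); split; first by split=> //; apply: pb_hom_ext.
move=> k' [k'1 k'2]; apply: pb_hom_ext => //=; apply: kU; split.
  by rewrite -k'1.
by rewrite -k'2; exists (pb_eq K), (pb_eq (pb_lift_ob u)); exact: (pb_heq k').
Defined.

Definition pb_fibration : fibration pb_cat B' := Fibration pb_cleavage.
End Pullback.

Section Dual.
Variables (E B : category) (P : fibration E B).
Notation c := (fcleav P).

Record dual_hom (A D : E) : Type := DualHom {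
  dual_base : hom (P A) (P D);
  dual_fib : hom (lift_ob c dual_base) A;
  dual_vert : over P dual_fib (idm (P A))
}.

Lemma dual_hom_ext A D (b : hom (P A) (P D)) (x x' : hom (lift_ob c b) A) v v' :
  x = x' -> DualHom (A := A) (D := D) (dual_fib := x) v = DualHom (dual_fib := x') v'.
Proof. by move=> e; subst x'; rewrite (proof_irrelevance _ v v'). Qed.

(* [dual_comp_spec g f h] spells out that [h] is the composite of
   [f = (u, phi)] and [g = (v, psi)]: its base is [v ∘ u], and its vertical part
   is [(vu)^*G -k'-> u^*D -phi-> A], where [k'] is [u^*psi] preceded by the
   canonical isomorphism [(vu)^*G ≅ u^*v^*G]. *)
Definition dual_comp_spec A D G (g : dual_hom D G) (f : dual_hom A D)
    (h : dual_hom A G) : Prop :=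
  dual_base h = dual_base g ∘ dual_base f /\
  exists (k : hom (lift_ob c (dual_base h)) (lift_ob c (dual_base g)))
         (k' : hom (lift_ob c (dual_base h)) (lift_ob c (dual_base f))),
    (lift c (dual_base g) ∘ k = lift c (dual_base h) /\
     over P k (dual_base f)) /\
    (lift c (dual_base f) ∘ k' = dual_fib g ∘ k /\ over P k' (idm (P A))) /\
    dual_fib h = dual_fib f ∘ k'.

Lemma dual_comp_unique A D G (g : dual_hom D G) (f : dual_hom A D)
    (h h' : dual_hom A G) :
  dual_comp_spec g f h -> dual_comp_spec g f h' -> h = h'.
Proof.
case: h h' => b x vx [b' x' vx'] [/= e1 [k1 [k2 [[a1 a2] [[a3 a4] a5]]]]].
move=> [/= e2 [l1 [l2 [[b1 b2] [[b3 b4] b5]]]]].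
subst b b'.
have ek : k1 = l1.
  by apply: (cart_inj (lift_cartesian _ _) (lift_over _ _) a2 b2); rewrite a1 b1.
have ek' : k2 = l2.
  by apply: (cart_inj (lift_cartesian _ _) (lift_over _ _) a4 b4); rewrite a3 b3 ek.
by apply: dual_hom_ext; rewrite a5 b5 ek'.
Qed.

Definition dual_id (A : E) : dual_hom A A :=
  DualHom (lift_over c (idm (P A))).

Section Comp.
Variables (A D G : E) (g : dual_hom D G) (f : dual_hom A D).
Let b := dual_base g ∘ dual_base f.

Lemma dual_comp_factor1 :
  exists! k : hom (lift_ob c b) (lift_ob c (dual_base g)),
    lift c (dual_base g) ∘ k = lift c b /\ over P k (dual_base f).
Proof.
exact: cart_factor (lift_cartesian _ _) (lift_over _ _) (lift_over _ _).
Qed.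

Lemma dual_comp_factor2 :
  exists! k' : hom (lift_ob c b) (lift_ob c (dual_base f)),
    lift c (dual_base f) ∘ k' = dual_fib g ∘ the dual_comp_factor1 /\
    over P k' (idm (P A)).
Proof.
apply: cart_factor (lift_cartesian _ _) (lift_over _ _) _.
apply: (over_eq (over_comp (dual_vert g) (proj2 (theP dual_comp_factor1)))).
by rewrite comp1m compm1.
Qed.

Definition dual_comp : dual_hom A G.
Proof.
refine (@DualHom A G b (dual_fib f ∘ the dual_comp_factor2) _).
apply: (over_eq (over_comp (dual_vert f) (proj2 (theP dual_comp_factor2)))).
exact: comp1m.
Defined.

Lemma dual_compP : dual_comp_spec g f dual_comp.
Proof.
split=> //; exists (the dual_comp_factor1), (the dual_comp_factor2).
split; first exact: (theP dual_comp_factor1).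
by split; first exact: (theP dual_comp_factor2).
Qed.
End Comp.

Lemma dual_comp1m A D (f : dual_hom A D) : dual_comp (dual_id D) f = f.
Proof.
apply: dual_comp_unique (dual_compP _ _) _.
split; first by rewrite /= comp1m.
have [|k [[k1 k2] _]] := cart_factor (lift_cartesian c (idm (P D)))
  (lift_over _ _) (h := lift c (dual_base f)) (w := dual_base f).
  by apply: over_eq (lift_over _ _) _; rewrite comp1m.
exists k, (idm _); do 2?split=> //; rewrite ?compm1 //.
by split=> //; apply: over_id; apply: over_src (dual_vert f).
Qed.

Lemma dual_compm1 A D (f : dual_hom A D) : dual_comp f (dual_id A) = f.
Proof.
apply: dual_comp_unique (dual_compP _ _) _.
split; first by rewrite /= compm1.
have [|k [[k1 k2] _]] := cart_factor (lift_cartesian c (idm (P A)))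
  (lift_over _ _) (h := dual_fib f) (w := idm (P A)).
  by apply: over_eq (dual_vert f) _; rewrite comp1m.
exists (idm _), k; do 2?split=> //; rewrite ?compm1 //.
by apply: over_id; apply: over_src (dual_vert f).
Qed.

Lemma dual_compA A D G H (h : dual_hom G H) (g : dual_hom D G) (f : dual_hom A D) :
  dual_comp h (dual_comp g f) = dual_comp (dual_comp h g) f.
Proof.
apply: dual_comp_unique (dual_compP _ _) _.
move: (dual_comp h g) (dual_compP h g) => x [xb [k1 [k1' [[x1 x2] [[x3 x4] x5]]]]].
move: (dual_comp g f) (dual_compP g f) => y [yb [k2 [k2' [[y1 y2] [[y3 y4] y5]]]]].
move: (dual_comp x f) (dual_compP x f) => z [zb [k3 [k3' [[z1 z2] [[z3 z4] z5]]]]].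
split; first by rewrite zb xb yb compA.
have k13 : over P (k1 ∘ k3) (dual_base y) by rewrite yb; apply: over_comp.
have [|k4 [[w1 w2] _]] := cart_factor (lift_cartesian c (dual_base y))
    (lift_over _ _) (h := dual_fib h ∘ (k1 ∘ k3)) (w := idm (P A)).
  by apply: (over_eq (over_comp (dual_vert h) k13)); rewrite comp1m compm1.
exists (k1 ∘ k3), k4; split; first by rewrite compA x1 z1.
split=> //.
have e1 : k2 ∘ k4 = k1' ∘ k3.
{ apply: (cart_inj (lift_cartesian _ _) (lift_over c (dual_base g))
    (w := dual_base f)).
  - by apply: (over_eq (over_comp y2 w2)); rewrite compm1.
  - by apply: (over_eq (over_comp x4 z2)); rewrite comp1m.
  - by rewrite !compA y1 x3 w1 !compA. }
have e2 : k3' = k2' ∘ k4.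
{ apply: (cart_inj (lift_cartesian _ _) (lift_over c (dual_base f))
    (w := idm (P A))) => //.
  - by apply: (over_eq (over_comp y4 w2)); rewrite comp1m.
  - by rewrite z3 compA y3 -compA e1 x5 compA. }
by rewrite z5 y5 e2 compA.
Qed.

Definition dual_cat : category :=
  @Category E dual_hom dual_id dual_comp dual_comp1m dual_compm1 dual_compA.

Definition dual_proj : functor dual_cat B.
Proof. by refine (@Functor dual_cat B (fob P) dual_base _ _). Defined.

Section Lift.
Variables (D : E) (I : B) (u : hom I (P D)).
Let L := lift_ob c u.

Lemma dual_lift_factor :
  exists! t : hom (lift_ob c (fmap P (lift c u))) L,
    lift c u ∘ t = lift c (fmap P (lift c u)) /\ over P t (idm (P L)).
Proof.
apply: cart_factor (lift_cartesian _ _) (over_fmap _ _) _.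
by rewrite compm1; apply: lift_over.
Qed.

(* The cartesian lift of [u] in the dual is the pair [(u, idm (u^*D))]; as
   [P (u^*D) = I] is only propositional, [u] becomes [fmap P (lift c u)] and the
   identity becomes the canonical vertical isomorphism. *)
Definition dual_lift : dual_hom L D := DualHom (proj2 (theP dual_lift_factor)).

Lemma dual_lift_over : over dual_proj (dual_lift : hom (c := dual_cat) L D) u.
Proof. exact: (lift_over c u). Qed.

Lemma dual_lift_cartesian :
  is_cartesian dual_proj (dual_lift : hom (c := dual_cat) L D).
Proof.
move=> K h w /= hw.
have [t1 t2] := theP dual_lift_factor.
pose l := lift c u; have lc : is_cartesian P l := lift_cartesian c u.
have lo : over P l (fmap P l) := over_fmap _ _.
have eK := over_src (dual_vert h).
have [|a [[a1 a2] aU]] := cart_factor (lift_cartesian c (fmap P l))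
    (lift_over _ _) (h := lift c (dual_base h)) (w := w).
  by rewrite -hw; apply: lift_over.
have [|b [[b1 b2] bU]] := cart_factor (lift_cartesian c w)
    (lift_over _ _) (h := the dual_lift_factor ∘ a) (w := idm (P K)).
  by apply: (over_eq (over_comp t2 a2)); rewrite comp1m compm1.
have [|b' [[c1 c2] _]] := cart_factor (lift_cartesian c (dual_base h))
    (lift_over _ _) (h := l ∘ lift c w) (w := idm (P K)).
  by rewrite compm1 hw; apply: over_comp lo (lift_over _ _).
have b'b : b' ∘ b = idm _.
{ apply: (cart_inj (lift_cartesian _ _) (lift_over c (dual_base h))
    (w := idm (P K))).
  - by apply: (over_eq (over_comp c2 b2)); rewrite comp1m.
  - by apply: over_id; apply: over_src b2.
  - by rewrite compm1 compA c1 -compA b1 compA [l ∘ _]t1 a1. }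
have bb' : b ∘ b' = idm _.
{ apply: (cart_inj (lift_cartesian _ _) (lift_over c w) (w := idm (P K))).
  - by apply: (over_eq (over_comp b2 c2)); rewrite comp1m.
  - by apply: over_id; apply: over_src c2.
  - rewrite compm1 compA b1; apply: (cart_inj lc lo (w := w)).
    + by apply: (over_eq (over_comp (over_comp t2 a2) c2)); rewrite comp1m compm1.
    + exact: lift_over.
    + by rewrite !compA [l ∘ _]t1 a1 c1. }
have kv : over P (dual_fib h ∘ b') (idm (P K)).
  by apply: (over_eq (over_comp (dual_vert h) c2)); rewrite comp1m.
exists (DualHom kv); split.
  split=> //; apply: dual_comp_unique (dual_compP _ _) _; split=> //=.
  exists a, b; do 2?split=> //.
  by rewrite -compA b'b compm1.
move=> k [/= ek kb]; have := dual_compP dual_lift k.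
rewrite [dual_comp _ _]ek {ek}; case: k kb => kw kx kv' /= kb; subst kw.
move=> [_ /= [a' [b'' [[a'1 a'2] [[b''1 b''2] e]]]]]; apply: dual_hom_ext.
have ea : a = a' by apply: aU.
have eb : b = b'' by apply: bU; rewrite ea.
by rewrite e -eb -compA bb' compm1.
Qed.
End Lift.

Definition dual_cleavage : cleavage dual_proj :=
  @Cleavage dual_cat B dual_proj _ dual_lift dual_lift_over dual_lift_cartesian.

Definition dual_fibration : fibration dual_cat B := Fibration dual_cleavage.
End Dual.

(* The total category of the tower obtained by first dualizing [P2] over [E1] and
   then dualizing over [E0] the resulting map of fibrations over [E0], whose
   source is the composite fibration [E2^∨ -> E1 -> E0]. *)
Definition iterated_dual_total (E2 E1 E0 : category)
    (P2 : fibration E2 E1) (P1 : fibration E1 E0) : category :=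
  dual_cat (comp_fibration (dual_fibration P2) P1).

Section Simple.
Variables (C : category) (p : products C).
Notation "A × B" := (prod_ob p A B) (at level 40, left associativity).

Record simple_ob : Type := SimpleOb { simple_base : C; simple_fib : C }.

Definition simple_hom (A B : simple_ob) : Type :=
  hom (simple_base A) (simple_base B) *
  hom (simple_base A × simple_fib A) (simple_fib B).

Definition simple_id (A : simple_ob) : simple_hom A A := (idm _, pr2 p _ _).

(* (i, x) |-> (u i, f (i, x)) *)
Definition simple_act (A B : simple_ob) (f : simple_hom A B) :
    hom (simple_base A × simple_fib A) (simple_base B × simple_fib B) :=
  pairing p (fst f ∘ pr1 p _ _) (snd f).

Definition simple_comp (A B D : simple_ob) (g : simple_hom B D)
    (f : simple_hom A B) : simple_hom A D :=
  (fst g ∘ fst f, snd g ∘ simple_act f).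

Lemma simple_act_id A : simple_act (simple_id A) = idm _.
Proof. by rewrite /simple_act /= comp1m pairing_pr. Qed.

Lemma simple_act_comp A B D (g : simple_hom B D) (f : simple_hom A B) :
  simple_act (simple_comp g f) = simple_act g ∘ simple_act f.
Proof.
by rewrite {2}/simple_act pairing_comp /simple_act /= -!compA pr1_pairing.
Qed.

Definition simple_cat : category.
Proof.
refine (@Category simple_ob simple_hom simple_id simple_comp _ _ _).
- by move=> A B [u f]; rewrite /simple_comp /= comp1m pr2_pairing.
- by move=> A B [u f]; rewrite /simple_comp simple_act_id !compm1.
- move=> A B D G [w h] [v g] f.
  by rewrite /simple_comp simple_act_comp /= !compA.
Defined.

Definition simple_proj : functor simple_cat C.
Proof. by refine (@Functor simple_cat C simple_base (fun A B f => fst f) _ _). Defined.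

Definition simple_times : functor simple_cat C :=
  @Functor simple_cat C (fun A => simple_base A × simple_fib A) simple_act
    simple_act_id simple_act_comp.

Definition simple_cleavage : cleavage simple_proj.
Proof.
refine (@Cleavage simple_cat C simple_proj
  (fun D I u => SimpleOb I (simple_fib D)) (fun D I u => (u, pr2 p _ _)) _ _).
  by move=> D I u; exists eq_refl, eq_refl; rewrite /= comp1m compm1.
move=> D I u K [v h] w /= hw; exists (w, h); split.
  by rewrite /simple_comp /= pr2_pairing hw.
by move=> [w' h'] [[_ <-] <-]; rewrite /= pr2_pairing.
Defined.

Definition simple_fibration : fibration simple_cat C := Fibration simple_cleavage.
End Simple.

Section SubFibration.
Variables (C : category) (L : finite_limits C).

Record subob_ob : Type := SubobOb { subob_base : C; subob_sub : Sub subob_base }.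

Record subob_hom (x y : subob_ob) : Type := SubobHom {
  subob_arr : hom (subob_base x) (subob_base y);
  subob_le : sub_le (subob_sub x) (sub_pb L subob_arr (subob_sub y))
}.

Lemma subob_hom_ext x y (f g : subob_hom x y) : subob_arr f = subob_arr g -> f = g.
Proof.
case: f g => f hf [g hg] /= e; subst g.
by rewrite (proof_irrelevance _ hf hg).
Qed.

Definition subob_id (x : subob_ob) : subob_hom x x.
Proof. by exists (idm _); rewrite sub_pb_id; apply: sub_le_refl. Defined.

Definition subob_comp x y z (g : subob_hom y z) (f : subob_hom x y) : subob_hom x z.
Proof.
exists (subob_arr g ∘ subob_arr f); rewrite sub_pb_comp.
exact: sub_le_trans (subob_le f) (sub_pb_mono L _ (subob_le g)).
Defined.

Definition subob_cat : category.
Proof.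
refine (@Category subob_ob subob_hom subob_id subob_comp _ _ _).
- by move=> *; apply: subob_hom_ext; apply: comp1m.
- by move=> *; apply: subob_hom_ext; apply: compm1.
- by move=> *; apply: subob_hom_ext; apply: compA.
Defined.

Definition subob_proj : functor subob_cat C.
Proof. by refine (@Functor subob_cat C subob_base subob_arr _ _). Defined.

Definition subob_cleavage : cleavage subob_proj.
Proof.
refine (@Cleavage subob_cat C subob_proj
  (fun D I u => SubobOb (sub_pb L u (subob_sub D)))
  (fun D I u => @SubobHom (SubobOb (sub_pb L u (subob_sub D))) D u (sub_le_refl _))
  _ _).
  by move=> D I u; exists eq_refl, eq_refl; rewrite /= comp1m compm1.
move=> D I u K h w /= hw.
have hle : sub_le (subob_sub K) (sub_pb L w (sub_pb L u (subob_sub D))).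
  by rewrite -sub_pb_comp -hw; apply: subob_le.
exists (@SubobHom K (SubobOb (sub_pb L u (subob_sub D))) w hle).
split; first by split=> //; apply: subob_hom_ext.
by move=> k [_ kw]; apply: subob_hom_ext.
Defined.

Definition subob_fibration : fibration subob_cat C := Fibration subob_cleavage.
End SubFibration.

Section Dialectica.
Variables (C : category) (L : finite_limits C).
Local Notation p := (finlim_products L).
Notation "A × B" := (prod_ob p A B) (at level 40, left associativity).

Record dial_ob : Type := DialOb {
  dial_pos : C;
  dial_neg : C;
  dial_rel : Sub (dial_pos × dial_neg)
}.

(* ⟨pi_U, f#⟩ : U × Y -> U × X *)
Definition dial_left (U X Y : C) (fs : hom (U × Y) X) : hom (U × Y) (U × X) :=
  pairing p (pr1 p U Y) fs.

(* f × Y : U × Y -> V × Y *)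
Definition dial_right (U V Y : C) (f : hom U V) : hom (U × Y) (V × Y) :=
  pairing p (f ∘ pr1 p U Y) (pr2 p U Y).

Lemma dial_leftM U X Y Z (f : hom (U × Y) X) (k : hom (U × Z) Y) :
  dial_left (f ∘ dial_left k) = dial_left f ∘ dial_left k.
Proof. by rewrite /dial_left pairing_comp pr1_pairing. Qed.

Lemma dial_rightM U V W Y (g : hom V W) (f : hom U V) :
  dial_right Y (g ∘ f) = dial_right Y g ∘ dial_right Y f.
Proof.
by rewrite /dial_right pairing_comp -!compA pr1_pairing pr2_pairing.
Qed.

Lemma dial_exchange U V Y Z (f : hom U V) (k : hom (V × Z) Y) :
  dial_right Y f ∘ dial_left (k ∘ dial_right Z f) = dial_left k ∘ dial_right Z f.
Proof.
by rewrite /dial_left /dial_right !pairing_comp -compA !pr1_pairing pr2_pairing.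
Qed.

Record dial_hom (A B : dial_ob) : Type := DialHom {
  dial_fwd : hom (dial_pos A) (dial_pos B);
  dial_bwd : hom (dial_pos A × dial_neg B) (dial_neg A);
  dial_le : sub_le (sub_pb L (dial_left dial_bwd) (dial_rel A))
                   (sub_pb L (dial_right (dial_neg B) dial_fwd) (dial_rel B))
}.

Lemma dial_hom_ext A B (f g : dial_hom A B) :
  dial_fwd f = dial_fwd g -> dial_bwd f = dial_bwd g -> f = g.
Proof.
case: f g => f fs hf [g gs hg] /= e es; subst g gs.
by rewrite (proof_irrelevance _ hf hg).
Qed.

Definition dial_id (A : dial_ob) : dial_hom A A.
Proof.
exists (idm _) (pr2 p _ _).
by rewrite /dial_left /dial_right comp1m; apply: sub_le_refl.
Defined.

(* (u, z) |-> f# (u, g# (f u, z)) *)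
Definition dial_bwd_comp (A B D : dial_ob) (g : dial_hom B D) (f : dial_hom A B) :
    hom (dial_pos A × dial_neg D) (dial_neg A) :=
  dial_bwd f ∘
    dial_left (dial_bwd g ∘ dial_right (dial_neg D) (dial_fwd f)).

Definition dial_comp (A B D : dial_ob) (g : dial_hom B D) (f : dial_hom A B) :
    dial_hom A D.
Proof.
exists (dial_fwd g ∘ dial_fwd f) (dial_bwd_comp g f).
rewrite /dial_bwd_comp dial_leftM dial_rightM !sub_pb_comp.
apply: sub_le_trans (sub_pb_mono L _ (dial_le f)) _.
rewrite -sub_pb_comp dial_exchange sub_pb_comp.
by apply: sub_pb_mono; apply: dial_le.
Defined.

Definition dial_cat : category.
Proof.
refine (@Category dial_ob dial_hom dial_id dial_comp _ _ _).
- move=> A B f; apply: dial_hom_ext; first exact: comp1m.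
  rewrite /= /dial_bwd_comp /dial_left /dial_right /= pr2_pairing.
  by rewrite pairing_pr compm1.
- move=> A B f; apply: dial_hom_ext; first exact: compm1.
  by rewrite /= /dial_bwd_comp /dial_left /dial_right /= pr2_pairing comp1m
    pairing_pr compm1.
- move=> A B D G h g f; apply: dial_hom_ext; first exact: compA.
  rewrite /= /dial_bwd_comp /= /dial_bwd_comp -compA -dial_leftM; congr (_ ∘ _).
  by rewrite dial_rightM -!compA -dial_exchange -!compA.
Defined.
End Dialectica.

(* Main.v *)
Require Import Defs.
From Stdlib Require Import ssreflect ProofIrrelevance.
From Stdlib Require Import FunctionalExtensionality ClassicalEpsilon.

Set Implicit Arguments.
Unset Strict Implicit.
Unset Printing Implicit Defensive.

(** The fibers of [P2] are posets, so a morphism of the iterated dual between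
    objects [(U, X, α)] and [(V, Y, β)] is determined by its underlying
    [f : U -> V] and by the simple morphism [(id, s) : (U, Y) -> (U, X)] under
    its vertical part; what remains is the condition
    [⟨pi_U, s⟩^*α <= (f × Y)^*β], so that [(f, s)] is a Dialectica morphism.
    Composition is read off [dual_comp_spec]: the comparison maps [k] and [k']
    lie over [(f, pi_Z)] and [(id, g# ∘ (f × Z))]. *)

(** * Strict isomorphisms from fully faithful functors bijective on objects *)

Lemma functor_ext {C D : category} (F G : functor C D)
    (e : forall x, F x = G x) :
  (forall x y (f : hom x y), eqh (e y) ∘ fmap F f = fmap G f ∘ eqh (e x)) ->
  F = G.
Proof.
case: F G e => F Fm F1 FM [G Gm G1 GM] /= e he.
have eFG : F = G by apply: functional_extensionality.
subst G.
have em : Fm = Gm.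
  apply: functional_extensionality_dep => x.
  apply: functional_extensionality_dep => y.
  apply: functional_extensionality => f.
  by have := he x y f; rewrite !eqh_id comp1m compm1.
by subst Gm; f_equal; apply: proof_irrelevance.
Qed.

Lemma over_strict {E B : category} (P : functor E B) {A A' : E} (k : hom A A')
    (u : hom (P A) (P A')) : Defs.over P k u -> fmap P k = u.
Proof. by move=> [e [e']]; rewrite !eqh_id comp1m compm1. Qed.

Lemma cat_isomorphic_sym {C D : category} :
  cat_isomorphic C D -> cat_isomorphic D C.
Proof. by move=> [F [G [GF FG]]]; exists G, F. Qed.

Section FullyFaithful.
Variables (C D : category) (F : functor C D) (g : D -> C).
Hypothesis gK : forall y, F (g y) = y.
Hypothesis ff : forall x x' (h : hom (F x) (F x')), exists! f, fmap F f = h.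

Lemma ff_inj x x' (f f' : hom x x') : fmap F f = fmap F f' -> f = f'.
Proof.
by move=> e; have [k [_ kU]] := ff (fmap F f'); rewrite -(kU f) // -(kU f').
Qed.

Definition ff_inv_map y y' (h : hom y y') : hom (g y) (g y') :=
  the (ff (eqh (eq_sym (gK y')) ∘ h ∘ eqh (gK y))).

Lemma ff_inv_mapP y y' (h : hom y y') :
  fmap F (ff_inv_map h) = eqh (eq_sym (gK y')) ∘ h ∘ eqh (gK y).
Proof. exact: (theP (ff _)). Qed.

Definition ff_inv : functor D C.
Proof.
refine (@Functor D C g ff_inv_map _ _).
  by move=> y; apply: ff_inj; rewrite ff_inv_mapP fmap1 compm1 eqhK.
move=> y y' y'' h k; apply: ff_inj; rewrite fmapM !ff_inv_mapP -!compA.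
by congr (_ ∘ (_ ∘ _)); rewrite !compA eqhKV comp1m.
Defined.

Lemma fully_faithful_isomorphic :
  (forall x, g (F x) = x) -> cat_isomorphic C D.
Proof.
move=> Fg; exists F, ff_inv; split.
  apply: (functor_ext (F := functor_comp ff_inv F) (G := functor_id C)
    (e := Fg)) => x y f /=; apply: ff_inj.
  rewrite !fmapM ff_inv_mapP !fmap_eqh !compA eqh_trans eqh_id comp1m.
  (* The two sides carry proofs of [F (g (F x)) = F x] from [gK] and from [Fg]; proof irrelevance
     supplies this triangle identity. *)
  by congr (_ ∘ eqh _); apply: proof_irrelevance.
apply: (functor_ext (F := functor_comp F ff_inv) (G := functor_id D)
  (e := gK)) => x y f /=.
by rewrite ff_inv_mapP !compA eqhKV comp1m.
Qed.
End FullyFaithful.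

(** * Composition in the iterated dual, seen in the middle category *)

Section PullbackTower.
Variables (E B B' E0 : category) (F : fibration E B) (Q : functor B' B).
Variable P1 : fibration B' E0.
Local Notation P := (comp_fibration (dual_fibration (pb_fibration F Q)) P1).
Implicit Types x y z : pb_cat F Q.

(** The vertical part of [h] is itself a morphism of the inner dual; its base is the only datum kept
    once the fibers are posets. *)
Definition vert_base {x y} (h : dual_hom P x y) :
    hom (lift_ob (fcleav P1) (D := pb_base y) (dual_base h)) (pb_base x) :=
  dual_base (dual_fib h).

Lemma vert_base_over x y (h : dual_hom P x y) :
  Defs.over P1 (vert_base h) (idm (P1 (pb_base x))).
Proof. exact: (dual_vert h). Qed.

(** The inner dual's projection sends the chosen lifts of the composite fibration definitionally to
    those of [P1], so applying it to each equation of [dual_comp_spec] suffices. *)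
Lemma vert_base_comp_spec x y z (g : dual_hom P y z) (f : dual_hom P x y)
    (h : dual_hom P x z) :
  dual_comp_spec g f h ->
  exists (k : hom (lift_ob (fcleav P1) (D := pb_base z) (dual_base h))
                  (lift_ob (fcleav P1) (D := pb_base z) (dual_base g)))
         (k' : hom (lift_ob (fcleav P1) (D := pb_base z) (dual_base h))
                   (lift_ob (fcleav P1) (D := pb_base y) (dual_base f))),
    (lift (fcleav P1) (D := pb_base z) (dual_base g) ∘ k =
       lift (fcleav P1) (D := pb_base z) (dual_base h) /\
     Defs.over P1 k (dual_base f : hom (P1 (pb_base x)) (P1 (pb_base y)))) /\
    (lift (fcleav P1) (D := pb_base y) (dual_base f) ∘ k' = vert_base g ∘ k /\
     Defs.over P1 k' (idm (P1 (pb_base x)))) /\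
    vert_base h = vert_base f ∘ k'.
Proof.
move=> [_ [k [k' [[k1 k2] [[k3 k4] k5]]]]].
exists (dual_base k), (dual_base k'); split; last split.
- by split; [exact: (f_equal (fmap (dual_proj (pb_fibration F Q))) k1) | exact: k2].
- by split; [exact: (f_equal (fmap (dual_proj (pb_fibration F Q))) k3) | exact: k4].
- exact: (f_equal (fmap (dual_proj (pb_fibration F Q))) k5).
Qed.
End PullbackTower.

(** Chosen lifts in the simple fibration have a projection as second component, so the second
    components of the two lifting equations read off [snd k] and then [snd k']. *)
Lemma simple_vertical_comp {C : category} {p : products C} {U V X Y Z W : C}
    {f : hom U V} {g : hom V W}
    {s : simple_hom p (SimpleOb U Y) (SimpleOb U X)}
    {t : simple_hom p (SimpleOb V Z) (SimpleOb V Y)}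
    {k : simple_hom p (SimpleOb U Z) (SimpleOb V Z)}
    {k' : simple_hom p (SimpleOb U Z) (SimpleOb U Y)} :
  snd (simple_comp (B := SimpleOb V Z) (D := SimpleOb W Z) (g, pr2 p V Z) k) =
    pr2 p U Z ->
  fst k = f ->
  simple_comp (B := SimpleOb U Y) (D := SimpleOb V Y) (f, pr2 p U Y) k' =
    simple_comp t k ->
  fst k' = idm U ->
  snd (simple_comp s k') =
    snd s ∘ pairing p (pr1 p U Z)
      (snd t ∘ pairing p (f ∘ pr1 p U Z) (pr2 p U Z)).
Proof.
move=> k2 k1 e k'1; have := f_equal snd e; move: k2.
rewrite /= !pr2_pairing => k2 k'2.
by rewrite /simple_act k'1 k'2 comp1m /simple_act k1 k2.
Qed.

(** * Morphisms of the tower as inequalities of subobjects *)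

Section SimpleTower.
Variables (C : category) (L : finite_limits C) (p : products C).
Local Notation P2 := (pb_fibration (subob_fibration L) (simple_times p)).

(* The element of [Sub (U × X)] given by an object of the fiber of [P2] over
   [(U, X)]. *)
Definition fiber_rel (x : pb_cat (subob_fibration L) (simple_times p)) :
    Sub (simple_times p (pb_base x)) :=
  eq_rect _ (Sub (C := C)) (subob_sub (pb_top x)) _ (pb_eq x).

(** Equality is strict because chosen lifts of subobjects are given by [sub_pb]; once [J] is
    substituted, the remaining transport is along a loop. *)
Lemma fiber_rel_lift (D : pb_cat (subob_fibration L) (simple_times p))
    (I : simple_cat p) (u : hom I (pb_base D)) :
  fiber_rel (lift_ob (fcleav P2) (D := D) u) =
  sub_pb L (simple_act u) (fiber_rel D).
Proof.
case: D u => [[J α] X e] /= u; rewrite /fiber_rel /=; simpl in e; subst J.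
move: (over_src _) => /= e; rewrite (proof_irrelevance _ e eq_refl) /=.
by rewrite /pb_below /= comp1m.
Qed.

(** [pb_heq] identifies the top arrow of [k] with [simple_act] of its base, up to transport. *)
Lemma pb_sub_le {D E : pb_cat (subob_fibration L) (simple_times p)}
    (k : hom D E) :
  sub_le (fiber_rel D) (sub_pb L (simple_act (pb_hbase k)) (fiber_rel E)).
Proof.
case: D E k => [[I α] X e] [[J β] Y e'] [[t le] u /= E]; simpl in *; subst I J.
move: E le; rewrite /fiber_rel /= comp1m compm1.
by move=> ->.
Qed.

Lemma pb_sub_exists {D E : pb_cat (subob_fibration L) (simple_times p)}
    (u : hom (c := simple_cat p) (pb_base D) (pb_base E)) :
  sub_le (fiber_rel D) (sub_pb L (simple_act u) (fiber_rel E)) ->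
  exists k : hom D E, pb_hbase k = u.
Proof.
case: D E u => [[I α] X e] [[J β] Y e'] u; simpl in *; subst I J => le.
pose t := @SubobHom C L (SubobOb α) (SubobOb β) (simple_act u) le.
have et : eqh eq_refl ∘ fmap (subob_fibration L) t =
    fmap (simple_times p) u ∘ eqh eq_refl.
  by rewrite /= comp1m compm1.
by exists (PbHom (P := subob_fibration L) (Q := simple_times p)
  (x := PbOb _) (y := PbOb _) et).
Qed.

Lemma pb_sub_faithful {D E : pb_cat (subob_fibration L) (simple_times p)}
    (k k' : hom D E) : pb_hbase k = pb_hbase k' -> k = k'.
Proof.
move=> e; apply: pb_hom_ext => //; apply: subob_hom_ext.
have := f_equal (comp (eqh (eq_sym (pb_eq E)))) (pb_heq k').
by rewrite -e -(pb_heq k) !compA !eqhK !comp1m.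
Qed.

Lemma dual_sub_base {D E : pb_cat (subob_fibration L) (simple_times p)}
    (k : dual_hom P2 D E) : pb_hbase (dual_fib k) = idm _.
Proof. exact: (over_strict (dual_vert k)). Qed.

(** The fiber part of [k] runs from the reindexed [E] to [D] over an identity, which reverses the
    inequality of [pb_sub_le]. *)
Lemma dual_sub_le {D E : pb_cat (subob_fibration L) (simple_times p)}
    (k : dual_hom P2 D E) :
  sub_le (sub_pb L (simple_act (dual_base k)) (fiber_rel E)) (fiber_rel D).
Proof.
have := pb_sub_le (dual_fib k).
by rewrite dual_sub_base fiber_rel_lift simple_act_id sub_pb_id.
Qed.

Lemma dual_sub_exists {D E : pb_cat (subob_fibration L) (simple_times p)}
    (u : hom (c := simple_cat p) (pb_base D) (pb_base E)) :
  sub_le (sub_pb L (simple_act u) (fiber_rel E)) (fiber_rel D) ->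
  exists k : dual_hom P2 D E, dual_base k = u.
Proof.
move=> le.
have [|k kb] := pb_sub_exists (D := lift_ob (fcleav P2) (D := E) u) (E := D)
  (u := idm (c := simple_cat p) (pb_base D)).
  by rewrite fiber_rel_lift simple_act_id sub_pb_id.
have kv : Defs.over P2 k (idm (pb_base D)).
  by apply: over_eq (over_fmap P2 k) _; exact: kb.
by exists (DualHom kv).
Qed.

Lemma dual_sub_faithful {D E : pb_cat (subob_fibration L) (simple_times p)}
    (k k' : dual_hom P2 D E) : dual_base k = dual_base k' -> k = k'.
Proof.
move: (dual_sub_base k) (dual_sub_base k').
case: k k' => u b v [u' b' v'] /= eb eb' e; subst u'.
by apply: dual_hom_ext; apply: pb_sub_faithful; rewrite eb eb'.
Qed.
End SimpleTower.

(** * The comparison functor from the Dialectica category *)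

Section Dial.
Variables (C : category) (L : finite_limits C).
Local Notation p := (finlim_products L).
Local Notation T := (iterated_dual_total
  (pb_fibration (subob_fibration L) (simple_times p)) (simple_fibration p)).

(** With [eq_refl] as compatibility proof, [fiber_rel] of the result computes to [dial_rel A], so
    hom-sets between embedded objects involve no transport on objects. *)
Definition dial_embed (A : dial_cat L) : T :=
  PbOb (P := subob_fibration L) (Q := simple_times p)
    (pb_top := SubobOb (dial_rel A))
    (pb_base := SimpleOb (dial_pos A) (dial_neg A)) eq_refl.

Definition dial_unembed (x : T) : dial_cat L := DialOb (fiber_rel x).

Lemma dial_embedK A : dial_unembed (dial_embed A) = A.
Proof. by case: A. Qed.

Lemma dial_unembedK x : dial_embed (dial_unembed x) = x.
Proof. by case: x => [[I α] [U X] /= e]; subst I. Qed.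

Section Hom.
Variables A B : dial_cat L.
Implicit Types h : hom (dial_embed A) (dial_embed B).

Definition vert h :
    simple_hom p (SimpleOb (dial_pos A) (dial_neg B))
      (SimpleOb (dial_pos A) (dial_neg A)) :=
  vert_base h.

Lemma vert1 h : fst (vert h) = idm _.
Proof. exact: (over_strict (vert_base_over h)). Qed.

(** The outer dual makes the vertical part run from the reindexed [B] to [A]; the inner dual turns
    the inequality around again, so [A] ends up on the left. *)
Lemma vert_le h :
  sub_le (sub_pb L (dial_left (snd (vert h))) (dial_rel A))
         (sub_pb L (dial_right L (dial_neg B) (dual_base h)) (dial_rel B)).
Proof.
have := dual_sub_le (dual_fib h).
(* The chosen lift of [f] is [(f, pr2)], whose action is [f × Y]. *)
rewrite (fiber_rel_lift (D := dial_embed B)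
  (I := SimpleOb (dial_pos A) (dial_neg B)) (dual_base h, pr2 p _ _)).
by rewrite /dial_left -[pr1 _ _ _]comp1m -(vert1 h).
Qed.

Definition dial_of h : hom A B := DialHom (vert_le h).

Lemma dial_of_inj h h' : dial_of h = dial_of h' -> h = h'.
Proof.
move=> e.
have e1 : dual_base h = dual_base h' by exact: (f_equal (@dial_fwd _ _ _ _) e).
have e2 : snd (vert h) = snd (vert h')
  by exact: (f_equal (@dial_bwd _ _ _ _) e).
have e3 : vert h = vert h' by apply: injective_projections; rewrite ?vert1.
clear e e2; case: h h' e1 e3 => f d v [f' d' v'] /= e1; subst f'.
by rewrite /vert => e; apply: dual_hom_ext; apply: dual_sub_faithful.
Qed.

Lemma dial_of_surj (k : hom A B) : exists h, dial_of h = k.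
Proof.
case: k => f s le.
pose P := comp_fibration
  (dual_fibration (pb_fibration (subob_fibration L) (simple_times p)))
  (simple_fibration p).
(* The vertical part must lie over an identity of [U], which forces the first component of [u]. *)
pose u : simple_hom p (SimpleOb (dial_pos A) (dial_neg B))
  (SimpleOb (dial_pos A) (dial_neg A)) := (idm _, s).
have [|d du] := dual_sub_exists (D := lift_ob (fcleav P) (D := dial_embed B) f)
  (E := dial_embed A) (u := u).
  rewrite (fiber_rel_lift (D := dial_embed B)
    (I := SimpleOb (dial_pos A) (dial_neg B)) (f, pr2 p _ _)).
  by move: le; rewrite /dial_left /simple_act /= comp1m.
have dv : Defs.over P d (idm (dial_pos A)).
  by apply: over_eq (over_fmap P d) _; rewrite /= du.
exists (@DualHom _ _ P (dial_embed A) (dial_embed B) f d dv).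
by apply: dial_hom_ext => //; rewrite /= /vert /vert_base /= du.
Qed.
End Hom.

Lemma dial_of_comp A B D (g : hom (dial_embed B) (dial_embed D))
    (f : hom (dial_embed A) (dial_embed B)) :
  dial_of (g ∘ f) = dial_of g ∘ dial_of f.
Proof.
have spec := dual_compP g f; apply: dial_hom_ext; first exact: (proj1 spec).
have [k [k' [[k1 k2] [[k3 k4] k5]]]] := vert_base_comp_spec spec.
apply: (eq_trans (f_equal snd k5)).
exact: (simple_vertical_comp (f_equal snd k1) (over_strict k2) k3
  (over_strict k4)).
Qed.

Lemma dial_of_id A : dial_of (idm (dial_embed A)) = idm A.
Proof. exact: dial_hom_ext. Qed.

(** Preimages exist only propositionally, hence the choice; [dial_of_inj] makes the chosen one
    unique and so functorial. *)
Definition dial_from A B (f : hom A B) : hom (dial_embed A) (dial_embed B) :=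
  proj1_sig (constructive_indefinite_description _ (dial_of_surj f)).

Lemma dial_fromK A B (f : hom A B) : dial_of (dial_from f) = f.
Proof.
exact: (proj2_sig (constructive_indefinite_description _ (dial_of_surj f))).
Qed.

Definition dial_functor : functor (dial_cat L) T.
Proof.
refine (@Functor (dial_cat L) T dial_embed dial_from _ _) => [A|A B D g f];
  apply: dial_of_inj.
  by rewrite dial_fromK dial_of_id.
by rewrite dial_of_comp !dial_fromK.
Defined.

Lemma dial_functor_ff A B (h : hom (dial_functor A) (dial_functor B)) :
  exists! f, fmap dial_functor f = h.
Proof.
exists (dial_of h); split; first by apply: dial_of_inj; rewrite dial_fromK.
by move=> f <-; apply: dial_fromK.
Qed.
End Dial.

Theorem mainTheorem2 (C : category) (L : finite_limits C) :
  cat_isomorphic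
    (iterated_dual_total
       (pb_fibration (subob_fibration L) (simple_times (finlim_products L)))
       (simple_fibration (finlim_products L)))
    (dial_cat L).
Proof.
apply: cat_isomorphic_sym.
exact: (fully_faithful_isomorphic (F := dial_functor L)
  (@dial_unembedK C L) (@dial_functor_ff C L) (@dial_embedK C L)).
Qed.
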